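(* Let $A$ be a dcpo with a $\mu$Info-structure $(A,\mathcal I,\mathcal M(\mathcal I),\mu,\mathrm{Info},\mathrm{Neginfo})$ and the induced relaxed metric $\rho=\langle l,u\rangle$. Then for all $x,y\in\mathrm{Total}(A)$, $l(x,y)=u(x,y)$. Moreover, defining $d:\mathrm{Total}(A)\times\mathrm{Total}(A)\to\mathbb R$ by $d(x,y)=l(x,y)=u(x,y)$, the pair $(\mathrm{Total}(A),d)$ is a metric space, and its metric topology is the subspace topology induced by the Scott topology on $A$.
   Context: Directed sets are nonempty. A dcpo is a poset with least element in which every directed subset has a least upper bound. $U\subseteq A$ is Scott open if it is upward closed and meets every directed $S$ with $\sqcup S\in U$. $\mathrm{Total}(A)$ is the set of maximal elements of $A$. A $\mu$Info-structure on a dcpo $A$ is a tuple $(A,\mathcal I,\mathcal M(\mathcal I),\mu,\mathrm{Info},\mathrm{Neginfo})$ where $\mathcal I$ is a set, $\mathcal M(\mathcal I)\subseteq\mathcal P(\mathcal I)$ is closed under $\cap,\cup,\setminus$ and contains $\emptyset$ and $\mathcal I$, $\mu:\mathcal M(\mathcal I)\to[0,1]$, and $\mathrm{Info},\mathrm{Neginfo}:A\to\mathcal M(\mathcal I)$, satisfying: 1. $\mu(\mathcal I)=1$, $\mu(\emptyset)=0$; $U\subseteq V\Rightarrow\mu(U)\le\mu(V)$; $\mu(U)+\mu(V)=\mu(U\cap V)+\mu(U\cup V)$. 2. $x\sqsubseteq y\Leftrightarrow\mathrm{Info}(x)\subseteq\mathrm{Info}(y)$; and $x\sqsubset y\Rightarrow\mathrm{Info}(x)\subsetneq\mathrm{Info}(y)$.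 3. $\mathrm{Info}(x)\cap\mathrm{Neginfo}(x)=\emptyset$; $x\sqsubseteq y\Rightarrow\mathrm{Neginfo}(x)\subseteq\mathrm{Neginfo}(y)$. 4. (Strong respect for totality) $x\in\mathrm{Total}(A)\Rightarrow\mathrm{Info}(x)\cup\mathrm{Neginfo}(x)=\mathcal I$. 5. For every directed $B\subseteq A$ and $y\in A$, and for each choice of $P,Q\in\{\mathrm{Info},\mathrm{Neginfo}\}$: $\mu(P(\sqcup B)\cap Q(y))=\sup_{x\in B}\mu(P(x)\cap Q(y))$. 6. For every Scott open $U\subseteq A$ and $x\in U$ there is $\epsilon>0$ such that for all $y\in A$, $\mu(\mathrm{Info}(x))-\mu(\mathrm{Info}(x)\cap\mathrm{Info}(y))<\epsilon$ implies $y\in U$. The induced relaxed metric is $\rho(x,y)=[l(x,y),u(x,y)]$ with $u(x,y)=1-\mu(\mathrm{Info}(x)\cap\mathrm{Info}(y))-\mu(\mathrm{Neginfo}(x)\cap\mathrm{Neginfo}(y))$ and $l(x,y)=\mu(\mathrm{Info}(x)\cap\mathrm{Neginfo}(y))+\mu(\mathrm{Info}(y)\cap\mathrm{Neginfo}(x))$. *)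

(* Defs.v *)
(* MathComp / MathComp-Analysis *)
From HB Require Import structures.
From mathcomp Require Import all_boot all_order all_algebra.
From mathcomp Require Import all_classical all_reals all_analysis.

Set Implicit Arguments.
Unset Strict Implicit.
Unset Printing Implicit Defensive.

Import Order.TTheory GRing.Theory Num.Theory.

Local Open Scope classical_set_scope.
Local Open Scope ring_scope.

Section Domain.
Context {disp : Order.disp_t} {A : porderType disp}.
Implicit Types (S U : set A) (x y : A).

Definition directed S :=
  S !=set0 /\
  forall x y, S x -> S y -> exists z, [/\ S z, (x <= z)%O & (y <= z)%O].

Definition scott_open U :=
  (forall x y, U x -> (x <= y)%O -> U y) /\
  (forall S s, directed S -> isLub S s -> U s -> S `&` U !=set0).

Definition Total : set A := [set x | forall y, (x <= y)%O -> y = x].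

End Domain.

(* The least element comes from [bPOrderType]. *)
Definition is_dcpo {disp : Order.disp_t} (A : bPOrderType disp) :=
  forall S : set A, directed S -> exists s, isLub S s.

(* [scott A] is a copy of [A] carrying the Scott topology. *)
Definition scott {disp : Order.disp_t} (A : porderType disp) : Type := A.

Section ScottTopology.
Context {disp : Order.disp_t} (A : porderType disp).

Lemma scott_openT : scott_open [set: A].
Proof.
by split=> // S s [[x Sx] _] _ _; exists x.
Qed.

Lemma scott_openI : setI_closed (@scott_open disp A).
Proof.
move=> U V [upU inU] [upV inV]; split=> [x y [Ux Vx] xy|S s dS lubs [Us Vs]].
  by split; [exact: upU xy|exact: upV xy].
have [x [Sx Ux]] := inU S s dS lubs Us.
have [y [Sy Vy]] := inV S s dS lubs Vs.
have [z [Sz xz yz]] := dS.2 x y Sx Sy.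
by exists z; split=> //; split; [exact: upU xz|exact: upV yz].
Qed.

Lemma scott_open_bigcup (J : Type) (U : J -> set A) :
  (forall j, scott_open (U j)) -> scott_open (\bigcup_j U j).
Proof.
move=> opU; split=> [x y [j _ Ujx] xy|S s dS lubs [j _ Ujs]].
  by exists j => //; exact: (opU j).1 xy.
have [x [Sx Ujx]] := (opU j).2 S s dS lubs Ujs.
by exists x; split=> //; exists j.
Qed.

HB.instance Definition _ := Choice.on (scott A).
HB.instance Definition _ := isOpenTopological.Build (scott A)
  scott_openT scott_openI scott_open_bigcup.

Lemma open_scottE : (open : set_system (scott A)) = @scott_open disp A.
Proof. by []. Qed.

End ScottTopology.

Record is_metric {R : realType} {T : Type} (d : T -> T -> R) : Prop := IsMetric {
  metric_ge0 : forall x y, 0 <= d x y ;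
  metric_eq0 : forall x y, d x y = 0 <-> x = y ;
  metric_symm : forall x y, d x y = d y x ;
  metric_tri : forall x y z, d x z <= d x y + d y z }.

(* [metric_space dm] is a copy of [T] carrying the metric [d] and its metric
   topology. *)
Definition metric_space {R : realType} {T : choiceType} {d : T -> T -> R}
  (dm : is_metric d) : Type := T.

Section MetricSpace.
Context {R : realType} {T : choiceType} {d : T -> T -> R} (dm : is_metric d).

Let dxx x : d x x = 0. Proof. exact/(metric_eq0 dm). Qed.
Let d_sep x y : d x y = 0 -> x = y. Proof. by move/(metric_eq0 dm). Qed.
Let d_tri y x z : d x z <= d x y + d y z. Proof. exact: (metric_tri dm). Qed.

HB.instance Definition _ := Choice.on (metric_space dm).
HB.instance Definition _ := isMetric.Build R (metric_space dm)
  dxx d_sep (metric_symm dm) d_tri.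

Lemma mdist_metric_spaceE : @mdist R (metric_space dm) = d.
Proof. by []. Qed.

Lemma open_metric_spaceP (V : set T) :
  open (V : set (metric_space dm)) <->
  forall x, V x -> exists2 e : R, 0 < e & [set y | d x y < e] `<=` V.
Proof.
have ballE (x : T) e : ball (x : metric_space dm) e = [set y | d x y < e].
  by rewrite ballEmdist.
rewrite openE /interior; split=> Vo x Vx.
  have /nbhs_ballP[e /= e0 eV] := Vo x Vx.
  by exists e => //; rewrite -ballE.
have [e e0 eV] := Vo x Vx.
by apply/nbhs_ballP; exists e => //; rewrite ballE.
Qed.

End MetricSpace.

(* [mu] is a function on all subsets of [I], but is constrained and used only on
   the members of [M]. *)
Record muInfo (R : realType) {disp : Order.disp_t} (A : porderType disp)
    (I : Type) := MuInfo {
  M : set (set I) ;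
  mu : set I -> R ;
  Info : A -> set I ;
  Neginfo : A -> set I ;
  M_set0 : M set0 ;
  M_setT : M setT ;
  M_setI : setI_closed M ;
  M_setU : setU_closed M ;
  M_setD : setD_closed M ;
  mu_range : forall U, M U -> 0 <= mu U <= 1 ;
  M_Info : forall x, M (Info x) ;
  M_Neginfo : forall x, M (Neginfo x) ;
  mu_setT : mu setT = 1 ;
  mu_set0 : mu set0 = 0 ;
  mu_mono : forall U V, M U -> M V -> U `<=` V -> mu U <= mu V ;
  mu_modular : forall U V, M U -> M V ->
    mu U + mu V = mu (U `&` V) + mu (U `|` V) ;
  Info_le : forall x y, (x <= y)%O <-> Info x `<=` Info y ;
  Info_lt : forall x y, (x < y)%O -> Info x `<` Info y ;
  Info_Neginfo : forall x, Info x `&` Neginfo x = set0 ;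
  Neginfo_le : forall x y, (x <= y)%O -> Neginfo x `<=` Neginfo y ;
  Info_total : forall x, Total x -> Info x `|` Neginfo x = setT ;
  mu_continuous : forall (B : set A) (b y : A) (P Q : A -> set I),
    directed B -> isLub B b ->
    (P = Info \/ P = Neginfo) -> (Q = Info \/ Q = Neginfo) ->
    mu (P b `&` Q y) = sup [set mu (P x `&` Q y) | x in B] ;
  mu_scott : forall (U : set A) (x : A), scott_open U -> U x ->
    exists2 e : R, 0 < e &
      forall y, mu (Info x) - mu (Info x `&` Info y) < e -> U y }.

(* The relaxed metric is the interval-valued map [x, y |-> `[rho_l x y, rho_u x y]]. *)
Section RelaxedMetric.
Context {R : realType} {disp : Order.disp_t} {A : porderType disp} {I : Type}.
Variable s : muInfo R A I.

Definition rho_u (x y : A) : R :=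
  1 - mu s (Info s x `&` Info s y) - mu s (Neginfo s x `&` Neginfo s y).

Definition rho_l (x y : A) : R :=
  mu s (Info s x `&` Neginfo s y) + mu s (Info s y `&` Neginfo s x).

Definition total_dist (x y : set_type (@Total disp A)) : R :=
  rho_l (val x) (val y).

End RelaxedMetric.

(* Main.v *)
Require Import Defs.
From mathcomp Require Import all_boot all_order all_algebra.
From mathcomp Require Import all_classical all_reals all_analysis.
From mathcomp Require Import lra.

Local Open Scope classical_set_scope.
Local Open Scope ring_scope.

Import Order.TTheory GRing.Theory Num.Theory.

(* A total [y] splits every measurable set [U] additively into [U `&` Info y]
   and [U `&` Neginfo y]. Cutting the whole space along [x] and [y] gives
   [l = u], and cutting [Info x `&` Neginfo z] along a total [y] gives the
   triangle inequality. Continuity of [mu] along directed sets makes the balls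
   [{z | u x z < e}] Scott open in all of [A], so metric open sets are relatively
   Scott open; conversely [mu (Info x) - mu (Info x `&` Info y) <= l x y] for
   total [y], so [mu_scott] puts a metric ball inside each Scott open set. *)

Section MuInfoTheory.
Context {R : realType} {disp : Order.disp_t} {A : porderType disp} {I : Type}.
Variable s : muInfo R A I.
Implicit Types (U V : set I) (x y z : A).

Lemma mu_ge0 U : M s U -> 0 <= mu s U.
Proof. by move=> /mu_range/andP[]. Qed.

Lemma mu_le1 U : M s U -> mu s U <= 1.
Proof. by move=> /mu_range/andP[]. Qed.

Lemma mu_setU_le U V : M s U -> M s V -> mu s (U `|` V) <= mu s U + mu s V.
Proof.
move=> MU MV; rewrite mu_modular// lerDr.
exact/mu_ge0/M_setI.
Qed.

(** Modularity on the two pieces: [Info s y] and [Neginfo s y] are disjoint and, for total [y],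
    cover the whole space. *)
Lemma mu_splitE U y : M s U -> Total y ->
  mu s U = mu s (U `&` Info s y) + mu s (U `&` Neginfo s y).
Proof.
move=> MU Ty.
rewrite mu_modular; [|by apply: M_setI => //; exact: M_Info|
  by apply: M_setI => //; exact: M_Neginfo].
by rewrite -setIIr Info_Neginfo setI0 mu_set0 add0r -setIUr Info_total// setIT.
Qed.

Lemma rho_l_u x y : Total x -> Total y -> rho_l s x y = rho_u s x y.
Proof.
move=> Tx Ty; rewrite /rho_l /rho_u.
(* The four pieces cut out by [x] and [y] have measures summing to 1: the two mixed ones make up
   [rho_l], the other two are subtracted in [rho_u]. *)
have := mu_splitE _ _ (M_setT s) Tx; rewrite !setTI mu_setT.
rewrite (mu_splitE _ _ (M_Info s x) Ty) (mu_splitE _ _ (M_Neginfo s x) Ty).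
rewrite (setIC (Neginfo s x) (Info s y)); lra.
Qed.

Lemma rho_l_ge0 x y : 0 <= rho_l s x y.
Proof.
by rewrite addr_ge0//; apply/mu_ge0/M_setI; [exact: M_Info|exact: M_Neginfo|
  exact: M_Info|exact: M_Neginfo].
Qed.

Lemma rho_lxx x : rho_l s x x = 0.
Proof. by rewrite /rho_l Info_Neginfo mu_set0 addr0. Qed.

Lemma rho_lC x y : rho_l s x y = rho_l s y x.
Proof. exact: addrC. Qed.

Lemma mu_Info_Neginfo_triangle x y z : Total y ->
  mu s (Info s x `&` Neginfo s z) <=
  mu s (Info s x `&` Neginfo s y) + mu s (Info s y `&` Neginfo s z).
Proof.
move=> Ty; have MIN u v : M s (Info s u `&` Neginfo s v).
  by apply: M_setI; [exact: M_Info|exact: M_Neginfo].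
apply: le_trans (mu_setU_le _ _ (MIN _ _) (MIN _ _)).
apply: mu_mono => //; first exact: M_setU.
move=> i [xi zi]; have : (Info s y `|` Neginfo s y) i by rewrite Info_total.
by case=> yi; [right|left].
Qed.

Lemma rho_l_triangle x y z : Total y ->
  rho_l s x z <= rho_l s x y + rho_l s y z.
Proof.
move=> Ty; have := mu_Info_Neginfo_triangle x y z Ty.
have := mu_Info_Neginfo_triangle z y x Ty; rewrite /rho_l; lra.
Qed.

(** By splitting along [y], the left side is the first summand of [rho_l]. *)
Lemma mu_Info_diff_le_rho_l x y : Total y ->
  mu s (Info s x) - mu s (Info s x `&` Info s y) <= rho_l s x y.
Proof.
move=> Ty; rewrite (mu_splitE _ _ (M_Info s x) Ty) addrC addKr /rho_l lerDl.
by apply/mu_ge0/M_setI; [exact: M_Info|exact: M_Neginfo].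
Qed.

Lemma scott_open_not_le y : scott_open [set z | ~ (z <= y)%O].
Proof.
split=> [u v /= uy uv vy|S b _ [_ bmin] /= bny]; first exact/uy/(le_trans uv).
apply: contrapT => Sy; apply: bny; apply: bmin => z Sz.
by apply: contrapT => zny; apply: Sy; exists z.
Qed.

Lemma rho_l_eq0 x y : Total x -> Total y -> rho_l s x y = 0 -> x = y.
Proof.
move=> Tx Ty xy0; apply: esym; apply: Tx; apply: contrapT => nxy.
(* If [x] is not below [y], the Scott open set of points not below [y] contains [x]; distance 0 then
   forces [y] into it. *)
have [e e0 /(_ y) ye] := mu_scott s (scott_open_not_le y) nxy.
apply: ye (lexx y).
by rewrite (le_lt_trans (mu_Info_diff_le_rho_l _ _ Ty))// xy0.
Qed.

Lemma mu_sup_gt (B : set A) (b y : A) (P Q : A -> set I) (r : R) :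
  directed B -> isLub B b ->
  (P = Info s \/ P = Neginfo s) -> (Q = Info s \/ Q = Neginfo s) ->
  r < mu s (P b `&` Q y) -> exists2 x, B x & r < mu s (P x `&` Q y).
Proof.
move=> dB lubb PP QQ; rewrite (mu_continuous y dB lubb PP QQ) => rb.
have [|_ [x Bx <-] rx] := sup_gt _ rb; last by exists x.
by have [x Bx] := dB.1; exists (mu s (P x `&` Q y)), x.
Qed.

Lemma mu_Info_le x y z : (y <= z)%O ->
  mu s (Info s y `&` Info s x) <= mu s (Info s z `&` Info s x).
Proof.
move=> yz; apply: mu_mono; [by apply: M_setI; exact: M_Info..|].
by apply: setSI; apply/Info_le.
Qed.

Lemma mu_Neginfo_le x y z : (y <= z)%O ->
  mu s (Neginfo s y `&` Neginfo s x) <= mu s (Neginfo s z `&` Neginfo s x).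
Proof.
move=> yz; apply: mu_mono; [by apply: M_setI; exact: M_Neginfo..|].
by apply: setSI; exact: Neginfo_le.
Qed.

(** The ball uses [rho_u] because it decreases as [z] grows, which makes the ball upward closed;
    [rho_l] increases. *)
Lemma scott_open_rho_u_ball x (e : R) : scott_open [set z | rho_u s z x < e].
Proof.
rewrite /rho_u; split=> [y z /= ye yz|B b dB lubb /= be].
  have := mu_Info_le x _ _ yz; have := mu_Neginfo_le x _ _ yz; lra.
(* Half the slack at [b]: each of the two measures may drop by less than [h]. *)
pose h := (e - (1 - mu s (Info s b `&` Info s x)
                  - mu s (Neginfo s b `&` Neginfo s x))) / 2.
have h0 : 0 < h by rewrite /h; lra.
have [y By yh] := mu_sup_gt B b x (Info s) (Info s)
  (mu s (Info s b `&` Info s x) - h) dB lubb (or_introl erefl)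
  (or_introl erefl) ltac:(lra).
have [z Bz zh] := mu_sup_gt B b x (Neginfo s) (Neginfo s)
  (mu s (Neginfo s b `&` Neginfo s x) - h) dB lubb (or_intror erefl)
  (or_intror erefl) ltac:(lra).
have [w [Bw yw zw]] := dB.2 y z By Bz.
exists w; split=> //=.
have := mu_Info_le x _ _ yw; have := mu_Neginfo_le x _ _ zw.
move: yh zh; rewrite /h; lra.
Qed.

Lemma total_dist_is_metric : is_metric (total_dist s).
Proof.
have T (x : set_type (@Total disp A)) : Total (val x) by exact/set_mem/valP.
split=> [x y|x y|x y|x y z]; rewrite /total_dist.
- exact: rho_l_ge0.
- split=> [/rho_l_eq0 xy|->]; last exact: rho_lxx.
  exact/val_inj/xy.
- exact: rho_lC.
- exact: rho_l_triangle.
Qed.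

Lemma open_total_distP (dm : is_metric (total_dist s))
    (V : set (set_type (@Total disp A))) :
  open (V : set (metric_space dm)) <->
  open (V : set (set_type (@Total disp A : set (scott A)))).
Proof.
have T (x : set_type (@Total disp A)) : Total (val x) by exact/set_mem/valP.
rewrite open_metric_spaceP; split=> [Vo|[U Uo <-] x Ux].
  pose F (x : set_type (@Total disp A)) (e : R) : set (scott A) :=
    [set z | rho_u s z (val x) < e].
  (* Taking every [rho_u] ball whose trace on total points lies in [V] avoids choosing radii; on
     total points [rho_u] is the distance. *)
  exists (\bigcup_(p in [set p : set_type (@Total disp A) * R |
     [set y | total_dist s p.1 y < p.2] `<=` V]) F p.1 p.2).
    apply: bigcup_open => -[x e] _.
    by rewrite open_scottE; exact: scott_open_rho_u_ball.
  apply/seteqP; split=> [y [[x e] /= xeV xye]|x Vx].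
    apply: xeV => /=; rewrite /total_dist rho_lC.
    by rewrite rho_l_u.
  have [e e0 xeV] := Vo x Vx.
  exists (x, e) => //.
  (* The centre lies in its own ball because [rho_u] vanishes on the diagonal at total points. *)
  by rewrite /F /= -(rho_l_u _ _ (T x) (T x)) rho_lxx.
move: Uo; rewrite open_scottE => Uo.
have [e e0 eU] := mu_scott s Uo Ux.
exists e => // y xye; apply: eU.
exact: le_lt_trans (mu_Info_diff_le_rho_l _ _ (T y)) xye.
Qed.

End MuInfoTheory.

Theorem theorem11p1p2 (R : realType) (disp : Order.disp_t)
    (A : bPOrderType disp) (I : Type) (s : muInfo R A I) :
  is_dcpo A ->
  (forall x y : A, Total x -> Total y -> rho_l s x y = rho_u s x y) /\
  exists dm : is_metric (total_dist s),
    forall V : set (set_type (@Total disp A)),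
      open (V : set (metric_space dm)) <->
      open (V : set (set_type (@Total disp A : set (scott A)))).
Proof.
move=> _; split=> [x y|]; first exact: rho_l_u.
by exists (total_dist_is_metric s) => V; exact: open_total_distP.
Qed.
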